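(* There is a deterministic algorithm in the synchronous multi-port message-passing model with crash failures such that, for all sufficiently large $n$ and every $t$ with $0\le t<n$, writing $\alpha=\frac tn$, it solves binary consensus with at most $t$ crashes in at most $n+3(1+\lg n)$ rounds, with nodes sending at most $\bigl(\frac{5}{1-\alpha}\bigr)^{8} n\lg n$ messages in total, each message carrying one bit.
   Context: Model: $n$ nodes with distinct names in $\{1,\dots,n\}$; $n$ and $t$ are known to all nodes. Computation proceeds in synchronous rounds starting simultaneously; in a round any node may send messages to any set of other nodes (multi-port), and all messages sent in a round are delivered in that round. An adversary may crash up to $t$ nodes at times of its choosing; a crashed node performs no further activity. Binary consensus: each node has an input bit and must irrevocably decide so that each decided value is the input of some node, no two nodes decide differently, and every non-crashed node eventually decides and halts. Running time is the number of rounds until all non-faulty nodes have halted. $\lg$ is the base-2 logarithm. *)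

(* Defs.v *)
From mathcomp Require Import all_boot all_order all_algebra.
From mathcomp Require Import reals exp.

Set Implicit Arguments.
Unset Strict Implicit.
Unset Printing Implicit Defensive.

Import Order.TTheory GRing.Theory Num.Theory.

(* The name k in {1, ..., n} of a node is represented by the ordinal k - 1.   *)
(* [send s j = Some b] means that a node in state [s] sends the one-bit       *)
(* message [b] to [j]; [None] means that it sends nothing to [j].             *)
(* [next s m] is the state reached from [s] after receiving, in the same      *)
(* round, the message [m j] from each node [j].                               *)
Record protocol (n : nat) : Type := Protocol {
  state : Type;
  init : 'I_n -> bool -> state;
  send : state -> 'I_n -> option bool;
  next : state -> ('I_n -> option bool) -> state;
  decision : state -> option bool;
  halted : state -> bool
}.

(* Node [i] crashes in round [c] when [crash_round i = Some c], rounds being  *)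
(* numbered from 0. A crash may interrupt the sending: in round [c] only the  *)
(* messages addressed to nodes in [reached i] get sent. As protocols are      *)
(* deterministic, quantifying over all schedules covers adaptive adversaries. *)
Record adversary (n : nat) : Type := Adversary {
  crash_round : 'I_n -> option nat;
  reached : 'I_n -> {set 'I_n}
}.

Section Executions.

Variables (n : nat) (A : protocol n) (F : adversary n) (x : 'I_n -> bool).

Definition faulty : {set 'I_n} := [set i | crash_round F i != None].

(* [i] has not crashed in any of the rounds 0, ..., r. *)
Definition survives (r : nat) (i : 'I_n) : bool :=
  if crash_round F i is Some c then r < c else true.

Definition emitted (s : 'I_n -> state A) (r : nat) (i j : 'I_n) : option bool :=
  if [&& j != i, ~~ halted (s i) &
         survives r i || (crash_round F i == Some r) && (j \in reached F i)]
  then send (s i) j else None.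

(* The states after [r] rounds (that is, after rounds 0, ..., r - 1); a node  *)
(* that crashes in a round does not complete it.                              *)
Fixpoint config (r : nat) : 'I_n -> state A :=
  if r is r'.+1 then
    let s := config r' in
    fun i => if survives r' i && ~~ halted (s i)
             then next (s i) (fun j => emitted s r' j i) else s i
  else fun i => init A i (x i).

Definition decides (r : nat) (i : 'I_n) (b : bool) : Prop :=
  decision (config r i) = Some b.

Definition all_halted (r : nat) : Prop :=
  forall i, i \notin faulty -> halted (config r i).

Definition messages (T : nat) : nat :=
  \sum_(r < T) #|[set p : 'I_n * 'I_n | emitted (config r) r p.1 p.2 != None]|.

Definition validity : Prop :=
  forall r i b, decides r i b -> exists j, x j = b.

Definition agreement : Prop :=
  forall r r' i j b b', decides r i b -> decides r' j b' -> b = b'.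

Definition irrevocability : Prop :=
  forall r i b, decides r i b -> decides r.+1 i b.

Definition termination : Prop :=
  forall i, i \notin faulty ->
  exists r, (exists b, decides r i b) /\ halted (config r i).

End Executions.

Definition solves_consensus (n : nat) (A : protocol n) (t : nat) : Prop :=
  forall (F : adversary n) (x : 'I_n -> bool), #|faulty F| <= t ->
  [/\ validity A F x, agreement A F x, irrevocability A F x
    & termination A F x].

Local Open Scope ring_scope.

Definition lg (R : realType) (a : R) : R := ln a / ln 2.

Definition runs_within (R : realType) (n : nat) (A : protocol n) (t : nat)
    (B : R) : Prop :=
  forall (F : adversary n) (x : 'I_n -> bool), (#|faulty F| <= t)%N ->
  exists T : nat, T%:R <= B /\ all_halted A F x T.

(* Faulty nodes may still be sending when all non-faulty nodes have halted,   *)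
(* hence the bound is over all numbers of rounds [T].                         *)
Definition sends_at_most (R : realType) (n : nat) (A : protocol n) (t : nat)
    (B : R) : Prop :=
  forall (F : adversary n) (x : 'I_n -> bool), (#|faulty F| <= t)%N ->
  forall T : nat, (messages A F x T)%:R <= B.

(* Main.v *)
Require Import Defs.
From mathcomp Require Import all_boot all_order all_algebra.
From mathcomp Require Import reals exp.
From mathcomp Require Import zify lra ring boolp.

Set Implicit Arguments.
Unset Strict Implicit.
Unset Printing Implicit Defensive.

Import Order.TTheory GRing.Theory Num.Theory.

(* Let m = n - t. First, the value 1 is flooded for n - 1 rounds on a sparse  *)
(* overlay, each node forwarding it once, when it acquires it; afterwards all *)
(* nodes of a connected component of the live overlay hold the same bit.      *)
(* Then come about lg n rounds of probing: a node stays active as long as it  *)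
(* hears from an active node in each of its six blocks of neighbours. Since   *)
(* small sets expand, the nodes that made a given node survive double in      *)
(* number from round to round, hence two survivors have large live balls;     *)
(* these are joined by an overlay edge, so survivors agree and may decide.    *)
(* Since large sets are hit by most blocks, a constant fraction of the        *)
(* correct nodes survive. Finally about lg n query-reply phases inform the    *)
(* others: the query degree doubles and the number of undecided nodes halves. *)
(* The overlays exist by the union bound over uniformly random neighbour      *)
(* lists; their degrees are polynomials in q = n / m + 1.                     *)

(** Agreement is a backward argument. In the live component of a node that survives all [L] probing
    rounds, at least min(2^j, s) nodes are active j rounds before the end ([survivor_ball]), hence s
    nodes at the start. Two sets of s nodes meet or are joined by an overlay edge, so all survivors
    lie in one live component, and flooding has given it a single bit ([flood_component],
    [survivors_agree]). Progress is a forward argument. At least b correct nodes survive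
    ([correct_survivors]), and a node stays undecided after a query phase only if its query list
    misses all of them ([undecided_misses], [card_undecided]). The overlay properties hold for all
    node sets at once, so the choices of the adversary cannot affect them. Such overlays exist by
    counting ([card_fragile], [card_trapping]), where probabilities appear as cardinalities with
    denominators multiplied out. Flooding uses each overlay arc at most once and costs O(q^8 n); a
    probing round costs O(q^2 n) and a query phase O(q n). Thus the logarithm multiplies only q^2 n,
    and for large n the term in q^8 n is absorbed. When n is too small compared with q for sparse
    overlays, the complete one is affordable. *)

Lemma card_pairs (I J : finType) (P : I -> J -> bool) :
  #|[set p : I * J | P p.1 p.2]| = \sum_i #|[set j | P i j]|.
Proof.
rewrite -sum1_card (eq_bigl (fun p => P p.1 p.2)) => [|p]; last by rewrite inE.
rewrite -(pair_big_dep predT P (fun _ _ => 1)); apply: eq_bigr => i _.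
by rewrite -sum1_card; apply: eq_bigl => j; rewrite inE.
Qed.

Lemma card_bigcup_le (I T : finType) (P : pred I) (A : I -> {set T}) :
  #|\bigcup_(i | P i) A i| <= \sum_(i | P i) #|A i|.
Proof.
elim/big_rec2: _ => [|i k B _ leB]; first by rewrite cards0.
by apply: leq_trans (leq_card_setU _ _) _; rewrite leq_add2l.
Qed.

Lemma sum_double (f : nat -> nat) (l : nat) :
  \sum_(0 <= r < l.*2) f r = \sum_(0 <= k < l) (f k.*2 + f k.*2.+1).
Proof.
elim: l => [|l IHl]; first by rewrite !big_geq.
by rewrite doubleS !big_nat_recr //= IHl addnA.
Qed.

(** * The protocol *)

Section FloodProbeQuery.

(** [E] is the flooding overlay, [h c i] the block number [c] of nodes to which [i] listens while
    probing, and [Q k i] the set of nodes that [i] queries in phase [k]. *)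
Variables (n delta L : nat) (E : rel 'I_n).
Variables (h : 'I_delta -> 'I_n -> {set 'I_n}) (Q : nat -> 'I_n -> {set 'I_n}).

Definition flood_end := n.-1.
Definition probe_end := flood_end + L.
Definition query_end := probe_end + L.*2.

(** [fresh] marks a 1 acquired in the last round, or as input; [asked] holds the senders of the last
    round, which are the queriers when replies are due. *)
Record node := Node {
  clock : nat;
  name : 'I_n;
  bit : bool;
  fresh : bool;
  active : bool;
  asked : {set 'I_n}
}.

(** Probing uses the arcs of [h] backwards: a node sends to those that listen to it. From
    [probe_end] on, even offsets are query rounds and odd ones reply rounds. *)
Definition sends (s : node) (j : 'I_n) : bool :=
  if clock s < flood_end then fresh s && E (name s) j
  else if clock s < probe_end then active s && [exists b, name s \in h b j]
  else if odd (clock s - probe_end) then active s && (j \in asked s)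
  else ~~ active s && (j \in Q (clock s - probe_end)./2 (name s)).

Section Step.

Variables (s : node) (m : 'I_n -> option bool).

Definition heard : {set 'I_n} := [set j | m j != None].
Definition heard_one : bool := [exists j, m j == Some true].

Definition next_bit : bool :=
  if clock s < flood_end then bit s || heard_one
  else if [&& probe_end <= clock s, odd (clock s - probe_end), ~~ active s
            & heard != set0]
  then heard_one else bit s.

Definition next_fresh : bool :=
  [&& clock s < flood_end, ~~ bit s & heard_one].

(** A block may contain its owner, which receives no message from itself; the case [j == name s]
    counts it as heard. *)
Definition next_active : bool :=
  if clock s < flood_end then active s
  else if clock s < probe_end then
    active s && [forall b, [exists j in h b (name s),
                              (j == name s) || (j \in heard)]]
  else active s || odd (clock s - probe_end) && (heard != set0).

Definition step : node :=
  Node (clock s).+1 (name s) next_bit next_fresh next_active heard.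

End Step.

(* After the probing rounds, [active] means decided. The clock of a crashed   *)
(* node stops, so a node that crashed before [probe_end] never decides.       *)
Definition flood_probe_query : protocol n := {|
  Defs.state := node;
  init := fun i b => Node 0 i b b true set0;
  send := fun s j => if sends s j then Some (bit s) else None;
  Defs.next := step;
  decision := fun s => if (probe_end <= clock s) && active s then Some (bit s) else None;
  halted := fun s => query_end <= clock s
|}.

(** * Executions *)

Section Execution.

Variables (F : adversary n) (x : 'I_n -> bool).

Definition state_at (r : nat) : 'I_n -> node := config flood_probe_query F x r.
Definition mail (r : nat) (i j : 'I_n) : option bool :=
  emitted (A := flood_probe_query) F (state_at r) r i j.

(** Alive at the start of round [r]: a node that crashes in round [r] is included, since it may
    still send some messages. *)
Definition live (r : nat) (i : 'I_n) : bool :=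
  if crash_round F i is Some c then r <= c else true.

Arguments state_at : simpl never.
Arguments mail : simpl never.

Lemma state_atS r i : state_at r.+1 i =
  if survives F r i && ~~ (query_end <= clock (state_at r i))
  then step (state_at r i) (fun j => mail r j i) else state_at r i.
Proof. by []. Qed.

Lemma survivesE r i : survives F r i = live r.+1 i.
Proof. by []. Qed.

Lemma live_le r r' i : r <= r' -> live r' i -> live r i.
Proof. by rewrite /live => le_r; case: crash_round => // c; apply: leq_trans. Qed.

Lemma live_nonfaulty r i : i \notin faulty F -> live r i.
Proof. by rewrite inE negbK /live => /eqP->. Qed.

Lemma name_state_at r i : name (state_at r i) = i.
Proof.
by elim: r => // r IHr; rewrite state_atS; case: ifP.
Qed.

Lemma clock_state_at r i : live r i -> clock (state_at r i) = minn r query_end.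
Proof.
elim: r => [|r IHr] lr; first by rewrite min0n.
rewrite state_atS survivesE lr /=.
have /IHr ck := live_le (leqnSn r) lr.
by case: ifP => H /=; move: H; rewrite ck; lia.
Qed.

Lemma state_at_stay r i : ~~ (live r.+1 i && (r < query_end)) ->
  state_at r.+1 i = state_at r i.
Proof.
rewrite negb_and state_atS survivesE => H.
case: ifP => // /andP[lr]; rewrite lr /= in H; rewrite -leqNgt in H.
by rewrite (clock_state_at (live_le (leqnSn r) lr)); lia.
Qed.

Lemma state_at_step r i : live r.+1 i -> r < query_end ->
  state_at r.+1 i = step (state_at r i) (fun j => mail r j i).
Proof.
move=> lr ltr; rewrite state_atS survivesE lr /=.
by rewrite (clock_state_at (live_le (leqnSn r) lr)) -ltnNge ifT //; lia.
Qed.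

(** Induction principle for invariants of single nodes: in each round a node either keeps its state,
    being crashed or halted, or performs a [step], about which all nodes may be assumed to satisfy
    the invariant. *)
Lemma state_at_ind (P : nat -> 'I_n -> node -> Prop) :
  (forall i, P 0 i (state_at 0 i)) ->
  (forall r i, P r i (state_at r i) -> P r.+1 i (state_at r i)) ->
  (forall r i, live r.+1 i -> r < query_end -> clock (state_at r i) = r ->
     (forall j, P r j (state_at r j)) ->
     P r.+1 i (step (state_at r i) (fun j => mail r j i))) ->
  forall r i, P r i (state_at r i).
Proof.
move=> P0 Pstay Pstep; elim=> // r IHr i.
have [/andP[lr ltr]|/state_at_stay->] := boolP (live r.+1 i && (r < query_end)); last first.
  exact: Pstay.
rewrite state_at_step //; apply: Pstep => //.
by rewrite (clock_state_at (live_le (leqnSn r) lr)); lia.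
Qed.

Lemma mailP r i j b : mail r i j = Some b ->
  [/\ live r i, r < query_end, clock (state_at r i) = r, sends (state_at r i) j
    & b = bit (state_at r i)].
Proof.
rewrite /mail /emitted; case: ifP => // /and3P[_ nh lr].
have {}lr : live r i.
  case/orP: lr => [|/andP[/eqP lr _]]; last by rewrite /live lr.
  by rewrite survivesE; apply: live_le.
move: nh; rewrite /= clock_state_at // -ltnNge gtn_min ltnn orbF => ltr.
by case: ifP => // sij [<-]; split=> //; lia.
Qed.

(** Partial converse of [mailP]: delivery is guaranteed only if the sender completes the round,
    hence [live r.+1 i] here against [live r i] there. *)
Lemma mail_sent r i j : live r.+1 i -> r < query_end -> j != i -> sends (state_at r i) j ->
  mail r i j = Some (bit (state_at r i)).
Proof.
move=> lr ltr ji sij; rewrite /mail /emitted ji survivesE lr /=.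
by rewrite clock_state_at ?(live_le (leqnSn r)) // sij -ltnNge gtn_min ltr.
Qed.

Lemma heard_mail r i j :
  j \in heard (fun k => mail r k i) -> exists b, mail r j i = Some b.
Proof. by rewrite inE; case: mail => // b _; exists b. Qed.

Lemma heard_oneP r i : reflect (exists j, mail r j i = Some true)
  (heard_one (fun k => mail r k i)).
Proof.
by apply: (iffP existsP) => [[j /eqP Hj]|[j Hj]]; exists j => //; apply/eqP.
Qed.

Lemma bit_input r i : exists j, x j = bit (state_at r i).
Proof.
move: r i; apply: (state_at_ind (P := fun _ _ s => exists j, x j = bit s)) => //.
  by move=> i; exists i.
move=> r i lr ltr ck IH; rewrite /= /next_bit.
have H1 : heard_one (fun k => mail r k i) -> exists j, x j = true.
  by case/heard_oneP => j /mailP[_ _ _ _ ->].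
case: ifP => _.
  case: (boolP (bit (state_at r i))) (IH i) => //= _ [k xk].
  by case: (heard_one _) H1 => [/(_ isT)//|_]; exists k.
case: ifP => // /and4P[_ _ _ /set0Pn[j]].
case/heard_mail=> b mj; have [/H1//|/heard_oneP noone] := boolP (heard_one _).
case: b mj => mj; first by case: noone; exists j.
by case/mailP: mj => _ _ _ _ ->.
Qed.

(** * Flooding *)

Definition ones (r : nat) : {set 'I_n} := [set i | bit (state_at r i)].
(** With the empty set at round 0, inputs 1 count as newly acquired, and a stall at round 0 means
    that there is no 1 at all. *)
Definition ones_before (r : nat) : {set 'I_n} := if r is r'.+1 then ones r' else set0.

Lemma flood_end_query_end : flood_end <= query_end.
Proof. by rewrite /query_end /probe_end; lia. Qed.

Lemma flood_mono r : r < flood_end -> ones r \subset ones r.+1.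
Proof.
move=> ltr; apply/subsetP => i; rewrite !inE => bi.
have [/andP[lr lt3]|/state_at_stay->//] := boolP (live r.+1 i && (r < query_end)).
rewrite state_at_step //= /next_bit clock_state_at ?(live_le (leqnSn r)) //.
by rewrite gtn_min ltr bi.
Qed.

Lemma fresh_state_at r i : r <= flood_end -> live r i ->
  fresh (state_at r i) = (i \in ones r) && (i \notin ones_before r).
Proof.
case: r => [|r] ler lr; first by rewrite !inE andbT.
have lt3 : r < query_end by have := flood_end_query_end; lia.
rewrite !inE state_at_step //= /next_bit /next_fresh.
rewrite clock_state_at ?(live_le (leqnSn r)) // gtn_min ler /=.
by case: (bit _); case: (heard_one _).
Qed.

Lemma flood_mail r i j b : r < flood_end -> mail r i j = Some b ->
  [/\ i \in ones r, i \notin ones_before r, b & E i j].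
Proof.
move=> ltr /mailP[lr _ ck]; rewrite /sends ck ltr name_state_at => /andP[+ Eij ->].
by rewrite fresh_state_at ?(ltnW ltr) // inE => /andP[-> ->].
Qed.

Lemma flood_push r i j : r < flood_end -> live flood_end i -> live flood_end j -> E i j ->
  i \in ones r -> i \notin ones_before r -> j \in ones r.+1.
Proof.
move=> ltr li lj Eij Xi Pi; have lt3 := leq_trans ltr flood_end_query_end.
have [<-|ij] := eqVneq i j; first exact: (subsetP (flood_mono ltr)).
have [ler li' lj'] : [/\ r <= flood_end, live r i & live r j].
  by split; [exact: ltnW|exact: live_le (ltnW ltr) li|exact: live_le (ltnW ltr) lj].
rewrite inE state_at_step ?(live_le ltr) //= /next_bit clock_state_at // gtn_min ltr.
apply/orP; right; apply/heard_oneP; exists i.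
rewrite mail_sent ?(live_le ltr) //; first by move: Xi; rewrite inE => ->.
  by rewrite eq_sym.
by rewrite /sends clock_state_at // gtn_min ltr /= name_state_at Eij fresh_state_at // Xi Pi.
Qed.

(** A node forwards the 1 only once, but if it is no longer fresh then, by induction, its neighbour
    was informed earlier. *)
Lemma flood_edge r i j : r < flood_end -> live flood_end i -> live flood_end j -> E i j ->
  i \in ones r -> j \in ones r.+1.
Proof.
elim: r => [|r IHr] ltr li lj Eij Xi; last first.
  have [Pi|Pi] := boolP (i \in ones r).
    exact/(subsetP (flood_mono ltr))/IHr/Pi/Eij/lj/li/ltnW.
  exact: (flood_push ltr li lj Eij Xi Pi).
by apply: (flood_push ltr li lj Eij Xi); rewrite inE.
Qed.

(** When a round informs nobody, no node is fresh, so nothing is sent and nothing changes until the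
    end of flooding. *)
Lemma flood_stall r k : ones r \subset ones_before r -> r + k <= flood_end ->
  ones (r + k) \subset ones_before r.
Proof.
move=> stall; have H k' : r + k' <= flood_end ->
    ones (r + k') \subset ones_before (r + k') /\ ones (r + k') \subset ones_before r.
  elim: k' => [|k' IHk] ler; first by rewrite addn0.
  have ltr : r + k' < flood_end by lia.
  case: (IHk (ltnW ltr)) => S1 S2; suff S : ones (r + k').+1 \subset ones (r + k').
    by rewrite addnS; split=> //; apply: subset_trans S S2.
  apply/subsetP => i Xi; have [//|nXi] := boolP (i \in ones (r + k')).
  move: Xi nXi; rewrite !inE.
  have [/andP[lr lt3]|/state_at_stay->] := boolP (live (r + k').+1 i && (r + k' < query_end));
    last by move=> ->.
  rewrite state_at_step //= /next_bit clock_state_at ?(live_le (leqnSn (r + k'))) // gtn_min ltr /=.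
  case/orP => [->//|/heard_oneP[j /flood_mail-/(_ ltr)[Xj /negP Pj _ _]]].
  by case: Pj; apply: (subsetP S1).
by case/H.
Qed.

Definition live_edge : rel 'I_n :=
  [rel i j | [&& live flood_end i, live flood_end j & E i j]].

Hypothesis E_sym : symmetric E.

Lemma live_edge_sym : connect_sym live_edge.
Proof. by apply: sym_connect_sym => i j; rewrite /live_edge /= E_sym andbCA. Qed.

(* Until the component of p is saturated each round yields a new informed     *)
(* node, and there are only n nodes.                                          *)
Lemma flood_component p y : connect live_edge p y ->
  bit (state_at flood_end p) -> bit (state_at flood_end y).
Proof.
move=> cpy bp; pose C := [set y | connect live_edge p y].
have Xp : p \in ones flood_end by rewrite inE.
suff /orP[/subsetP S|big] : (C \subset ones flood_end) || (flood_end < #|ones flood_end|).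
- by have := S y; rewrite !inE; apply.
- have : ones flood_end = setT.
    by apply/eqP; rewrite eqEcard subsetT cardsT card_ord (leq_trans (leqSpred n) big).
  by move/setP/(_ y); rewrite !inE.
have: flood_end <= flood_end by []; elim: {-2}flood_end => [|r IHr] ler.
  apply/orP; right; rewrite lt0n cards_eq0; apply/negP => /eqP X0.
  have := @flood_stall 0 flood_end; rewrite X0 sub0set add0n => /(_ isT (leqnn _)).
  by move/subsetP/(_ _ Xp); rewrite inE.
case/orP: (IHr (ltnW ler)) => [S|big].
  by rewrite (subset_trans S (flood_mono ler)).
(* If the round stalls, the informed set is final; it contains [p], which ends up informed, and is
   closed under live edges, so it contains the component. Otherwise it gains a node. *)
have [S|nS] := boolP (ones r.+1 \subset ones r).
  have XpR : p \in ones r.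
    have := @flood_stall r.+1 (flood_end - r.+1) S; rewrite subnKC // leqnn => /(_ isT).
    by move/subsetP; apply.
  have cl : closed live_edge (mem (ones r)).
    apply: intro_closed; first exact: live_edge_sym.
    move=> i j /and3P[li lj Eij] Xi; apply/(subsetP S).
    exact: flood_edge Eij Xi.
  suff -> : C \subset ones r.+1 by [].
  apply: subset_trans (flood_mono ler); apply/subsetP => z; rewrite inE => cpz.
  by have := closed_connect cl cpz; rewrite /= XpR => <-.
apply/orP; right; apply: leq_ltn_trans big _; apply: proper_card.
by rewrite properE flood_mono.
Qed.

(** * Probing *)

Definition survivors (k : nat) : {set 'I_n} :=
  [set i | live (flood_end + k) i && active (state_at (flood_end + k) i)].

Lemma active_flood r i : r <= flood_end -> active (state_at r i).
Proof.
move: r i; apply: (state_at_ind (P := fun r _ s => r <= flood_end -> active s)) => //.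
  by move=> r i IH /ltnW/IH.
by move=> r i lr ltr ck IH ler /=; rewrite /next_active ck ler; apply/IH/ltnW.
Qed.

Lemma probe_mail k i j b : k < L -> mail (flood_end + k) i j = Some b ->
  i \in survivors k /\ (exists c, i \in h c j).
Proof.
move=> ltk /mailP[lr _ ck]; rewrite /sends ck name_state_at /probe_end.
rewrite ltnNge leq_addr /= ltn_add2l ltk => /andP[act /existsP hji] _.
by rewrite inE lr act.
Qed.

Lemma survivors_step k i : k < L -> (i \in survivors k.+1) =
  [&& live (flood_end + k.+1) i, i \in survivors k &
      [forall b, [exists j in h b i,
                    (j == i) || (j \in heard (fun j => mail (flood_end + k) j i))]]].
Proof.
move=> ltk; rewrite ![_ \in survivors _]in_set; have [lr|//] := boolP (live _ i) => /=.
have lt3 : flood_end + k < query_end by rewrite /query_end /probe_end; lia.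
have kE : flood_end + k.+1 = (flood_end + k).+1 by rewrite addnS.
rewrite kE in lr *; have lr' := live_le (leqnSn _) lr; rewrite lr' /=.
rewrite state_at_step //= /next_active clock_state_at // name_state_at (minn_idPl (ltnW lt3)).
by rewrite ltnNge leq_addr /= /probe_end ltn_add2l ltk.
Qed.

Lemma survivors_sub k : k < L -> survivors k.+1 \subset survivors k.
Proof. by move=> ltk; apply/subsetP => i; rewrite survivors_step // => /and3P[]. Qed.

Lemma survivors_hit k i b : k < L -> i \in survivors k.+1 ->
  exists2 j, j \in h b i & j \in survivors k.
Proof.
move=> ltk; rewrite survivors_step // => /and3P[_ si /forallP/(_ b)/existsP[j]].
case/andP => hj /orP[/eqP jE|/heard_mail[c /probe_mail[] //]]; last by exists j.
by exists j => //; rewrite jE.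
Qed.

Lemma survivors_sub_le k k' : k <= k' -> k' <= L -> survivors k' \subset survivors k.
Proof.
elim: k' => [|k' IHk]; first by rewrite leqn0 => /eqP->.
rewrite leq_eqVlt => /orP[/eqP->//|lek] ltk.
exact: subset_trans (survivors_sub ltk) (IHk lek (ltnW ltk)).
Qed.

Lemma live_survivors0 i k : k <= L -> i \in survivors k -> live flood_end i.
Proof.
by move=> lek /(subsetP (survivors_sub_le (leq0n k) lek)); rewrite inE addn0 => /andP[].
Qed.

Variables s b v : nat.
Hypothesis hE : forall c i j, j \in h c i -> E i j.
Hypothesis E_large : forall A B : {set 'I_n}, s <= #|A| -> s <= #|B| ->
  exists i j, [/\ i \in A, j \in B & (i == j) || E i j].
Hypothesis h_expands : forall A B : {set 'I_n}, 0 < #|A| < s ->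
  (forall i, i \in A -> forall c, exists2 j, j \in h c i & j \in B) ->
  #|A|.*2 <= #|B|.
Hypothesis leL : s <= 2 ^ L.

(** Not a metric ball: it takes in the whole live component of [p]. *)
Definition ball (p : 'I_n) (k : nat) : {set 'I_n} :=
  [set y in survivors k | connect live_edge p y].

(** One round further back, each node of the ball needs an active neighbour in every block. These
    neighbours lie in the same live component, and expansion doubles their number while it is below
    [s]. *)
Lemma survivor_ball p j : j <= L -> p \in survivors L ->
  minn (2 ^ j) s <= #|ball p (L - j)|.
Proof.
move=> + sp; elim: j => [|j IHj] lej.
  rewrite subn0 expn0 (leq_trans (geq_minl _ _)) // card_gt0; apply/set0Pn.
  by exists p; rewrite inE sp connect0.
move: (IHj (ltnW lej)); set N := ball p _; set N' := ball p _ => leN.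
have LE : L - j = (L - j.+1).+1 by lia.
have ltk : L - j.+1 < L by lia.
have [leNs|ltNs] := leqP s #|N|.
  rewrite (leq_trans (geq_minr _ _)) // (leq_trans leNs) // subset_leq_card //.
  apply/subsetP => y; rewrite [y \in N]in_set [y \in N']in_set => /andP[+ ->].
  by rewrite andbT LE; apply/subsetP/survivors_sub.
have N0 : 0 < #|N|.
  by rewrite (leq_trans _ leN) // leq_min expn_gt0 /=; lia.
have: #|N|.*2 <= #|N'|.
  apply: h_expands; rewrite ?N0 ?ltNs // => i; rewrite inE => /andP[si cpi] c.
  rewrite LE in si; have [y hy sy] := survivors_hit c ltk si; exists y => //.
  rewrite inE sy (connect_trans cpi) // connect1 // /live_edge /= (hE hy) andbT.
  by rewrite (live_survivors0 _ si) ?(live_survivors0 _ sy) //; lia.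
by move: leN; rewrite expnS; lia.
Qed.

Lemma bit_probe k i : k <= L ->
  bit (state_at (flood_end + k) i) = bit (state_at flood_end i).
Proof.
elim: k => [|k IHk] lek; first by rewrite addn0.
rewrite addnS -IHk 1?ltnW //.
have [/andP[lr lt3]|/state_at_stay->//] :=
  boolP (live (flood_end + k).+1 i && (flood_end + k < query_end)).
rewrite state_at_step //= /next_bit clock_state_at ?(live_le (leqnSn (flood_end + k))) //.
by rewrite (minn_idPl (ltnW lt3)) ltnNge leq_addr /= /probe_end leq_add2l leqNgt lek.
Qed.

Lemma survivors_agree p y : p \in survivors L -> y \in survivors L ->
  bit (state_at probe_end p) = bit (state_at probe_end y).
Proof.
have big z : z \in survivors L -> s <= #|ball z 0|.
  move=> sz; have := survivor_ball (leqnn L) sz; rewrite subnn.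
  by rewrite (minn_idPr leL).
move=> sp sy; have [i [j []]] := E_large (big _ sp) (big _ sy).
rewrite 2!inE addn0 => /andP[/andP[li _] cpi].
rewrite 2!inE addn0 => /andP[/andP[lj _] cyj] ij.
have cij : connect live_edge i j.
  by case/orP: ij => [/eqP->|Eij]; rewrite ?connect0 // connect1 // /live_edge /= li lj.
have cpy : connect live_edge p y.
  by rewrite (connect_trans cpi) // (connect_trans cij) // live_edge_sym.
rewrite !bit_probe //; apply/idP/idP; first exact: flood_component.
by apply: flood_component; rewrite live_edge_sym.
Qed.

Definition correct : {set 'I_n} := ~: faulty F.

Lemma live_correct r i : i \in correct -> live r i.
Proof. by rewrite inE; apply: live_nonfaulty. Qed.

Hypothesis leM : b + v <= #|correct|.
Hypothesis b_gt0 : 0 < b.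
Hypothesis h_robust : forall B : {set 'I_n}, b <= #|B| ->
  #|[set i | [exists c, [disjoint h c i & B]]]| <= v.

(** The sets of survivors decrease, so blocks that meet the correct survivors of round [k] met those
    of all earlier rounds: [i] cannot have been eliminated before. *)
Lemma correct_survives k i : k < L -> i \in correct ->
  (forall c, ~~ [disjoint h c i & correct :&: survivors k]) -> i \in survivors k.+1.
Proof.
move=> + Mi; have lv r : live r i by apply: live_correct.
have hit_heard k' : k' < L -> (forall c, ~~ [disjoint h c i & correct :&: survivors k']) ->
    [forall c, [exists j in h c i,
                (j == i) || (j \in heard (fun j => mail (flood_end + k') j i))]].
  move=> ltk hit; apply/forallP => c; have /pred0Pn[j /andP[/= hj]] := hit c.
  rewrite in_setI [j \in survivors _]in_set => /andP[Mj /andP[lj act]].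
  apply/existsP; exists j; rewrite hj /=; have [//|ji] := eqVneq j i.
  have lt3 : flood_end + k' < query_end by rewrite /query_end /probe_end; lia.
  rewrite inE mail_sent //; first exact: live_correct; first by rewrite eq_sym.
  rewrite /sends clock_state_at // (minn_idPl (ltnW lt3)) ltnNge leq_addr act name_state_at.
  by rewrite /probe_end ltn_add2l ltk /=; apply/existsP; exists c.
elim: k => [|k IHk] ltk hit; rewrite survivors_step // lv hit_heard // andbT /=.
  by rewrite inE lv addn0 active_flood.
apply: IHk (ltnW ltk) _ => c; apply: contra (hit c).
by apply: disjointWr; apply/setIS/survivors_sub/ltnW.
Qed.

(** Losses do not accumulate over the rounds: by [correct_survives], all correct nodes are retained
    except the at most [v] nodes some block of which misses the current set. *)
Lemma correct_survivors k : k <= L -> b <= #|correct :&: survivors k|.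
Proof.
elim: k => [|k IHk] lek.
  suff -> : correct :&: survivors 0 = correct by apply: leq_trans leM; rewrite leq_addr.
  apply/setIidPl/subsetP => i Mi.
  by rewrite inE live_correct ?addn0 ?active_flood.
pose Z := [set i | [exists c, [disjoint h c i & correct :&: survivors k]]].
have leZ : #|Z| <= v by apply: h_robust; apply: IHk (ltnW lek).
have: #|correct :\: Z| <= #|correct :&: survivors k.+1|.
  apply/subset_leq_card/subsetP => i; rewrite in_setD in_setI => /andP[nZ Mi].
  rewrite Mi correct_survives // => c; apply: contra nZ => dis.
  by rewrite inE; apply/existsP; exists c.
apply: leq_trans; rewrite -(leq_add2r v) (leq_trans leM) //.
rewrite -(cardsID Z correct) addnC leq_add2l (leq_trans _ leZ) //.
exact/subset_leq_card/subsetIr.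
Qed.

(** * Queries *)

Hypothesis L_gt0 : 0 < L.

Definition core : {set 'I_n} := correct :&: survivors L.

Lemma active_next r i : probe_end <= clock (state_at r i) -> active (state_at r i) ->
  [/\ probe_end <= clock (state_at r.+1 i), active (state_at r.+1 i)
    & bit (state_at r.+1 i) = bit (state_at r i)].
Proof.
move=> ck act.
have [/andP[lr lt3]|/state_at_stay->//] := boolP (live r.+1 i && (r < query_end)).
rewrite state_at_step //= /next_bit /next_active act andbF !ltnNge ck.
by rewrite (leq_trans (leq_addr _ _) ck) /= leqW.
Qed.

Lemma survivors_probe_end i :
  (i \in survivors L) = live probe_end i && active (state_at probe_end i).
Proof. by rewrite inE. Qed.

Lemma core_active r i : i \in core -> probe_end <= r -> active (state_at r i).
Proof.
rewrite in_setI survivors_probe_end => /andP[Ci /andP[_ act]] /subnKC<-.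
have lr k : live k i by apply: live_correct.
elim: (r - probe_end) => [|k IHk]; first by rewrite addn0.
rewrite addnS; case: (active_next _ IHk) => //.
by rewrite clock_state_at // leq_min leq_addr /query_end leq_addr.
Qed.

Lemma decided_bit k0 r i : k0 \in survivors L ->
  probe_end <= clock (state_at r i) -> active (state_at r i) ->
  bit (state_at r i) = bit (state_at probe_end k0).
Proof.
move=> sk0; move: r i.
apply: (state_at_ind (P := fun r i s =>
  probe_end <= clock s -> active s -> bit s = bit (state_at probe_end k0))) => //.
  by move=> i /=; rewrite /probe_end; lia.
move=> r i lr ltr ck IH; have [ltT2|] := ltnP r probe_end.
  rewrite -state_at_step // => ck'; move: (ck'); rewrite clock_state_at // => leT2 act.
  (* The clock reaches [probe_end] in this very round, so an active node is a survivor of the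
     probing. *)
  have rE : r.+1 = probe_end by lia.
  by rewrite rE in lr act *; apply: survivors_agree => //; rewrite survivors_probe_end lr.
move=> leT2 _ /=; rewrite /next_bit /next_active ck leT2.
have -> : (r < flood_end) = false by move: leT2; rewrite /probe_end; lia.
rewrite ltnNge leT2 /=.
case: (boolP (active (state_at r i))) => act /=; rewrite ?andbF.
  by move=> _; apply: IH; rewrite ?ck.
case/andP => od hd; rewrite od hd /=.
(* Repliers have decided, so all replies carry the common bit; as there is at least one reply,
   [heard_one] equals it. *)
have agree j b0 : mail r j i = Some b0 -> b0 = bit (state_at probe_end k0).
  case/mailP => lj _ ckj; rewrite /sends ckj.
  have -> : (r < flood_end) = false by move: leT2; rewrite /probe_end; lia.
  rewrite ltnNge leT2 od /= => /andP[actj _] ->.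
  by apply: IH; rewrite ?ckj.
have [/heard_oneP[j /agree//]|/heard_oneP none] := boolP (heard_one _).
have /set0Pn[j /heard_mail[[] mj]] := hd; first by case: none; exists j.
exact: agree mj.
Qed.

(** A core node never crashes and stays active, so it would receive the query and its reply would
    arrive. *)
Lemma undecided_misses k i : k < L -> live (probe_end + k.*2).+2 i ->
  ~~ active (state_at (probe_end + k.*2).+2 i) -> [disjoint Q k i & core].
Proof.
move=> ltk lr; apply: contraR => /pred0Pn[j /andP[/= Qj Kj]].
set r := probe_end + k.*2 in lr *.
have [lr1 lr0] := (live_le (leqnSn _) lr, live_le (leqW (leqnSn _)) lr).
have lt3 : r.+1 < query_end by rewrite /r /query_end; lia.
have nT1 : (r < flood_end) = false by rewrite /r /probe_end; lia.
have nT1' : (r.+1 < flood_end) = false by rewrite /r /probe_end; lia.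
have nT2 : (r < probe_end) = false by rewrite /r; lia.
have nT2' : (r.+1 < probe_end) = false by rewrite /r; lia.
have rE : r - probe_end = k.*2 by rewrite /r; lia.
have rE' : r.+1 - probe_end = k.*2.+1 by rewrite /r; lia.
have ck0 : clock (state_at r i) = r by rewrite clock_state_at //; lia.
have ck1 : clock (state_at r.+1 i) = r.+1 by rewrite clock_state_at //; lia.
have [act|act1] := boolP (active (state_at r.+1 i)).
  by case: (active_next _ act); rewrite // ck1 leqNgt nT2'.
have act0 : ~~ active (state_at r i).
  by apply: contra act1 => act; case: (active_next _ act); rewrite // ck0 leqNgt nT2.
have ljr k' : live k' j by apply: live_correct; move: Kj; rewrite in_setI => /andP[].
have ckj : clock (state_at r.+1 j) = r.+1 by rewrite clock_state_at //; lia.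
have actj : active (state_at r.+1 j) by apply: core_active => //; rewrite leqNgt nT2'.
have ij : i != j by apply: contra act1 => /eqP->.
rewrite state_at_step //= /next_active ck1 nT1' nT2' rE' /= odd_double /= (negbTE act1) /=.
apply/set0Pn; exists j; rewrite inE mail_sent //.
rewrite /sends ckj nT1' nT2' rE' /= odd_double actj /=.
rewrite state_at_step ?(ltnW lt3) //= inE mail_sent ?(ltnW lt3) //; first by rewrite eq_sym.
by rewrite /sends ck0 nT1 nT2 rE odd_double act0 /= name_state_at doubleK.
Qed.

Variable u : nat -> nat.
Hypothesis u0 : n <= u 0.
Hypothesis uL : u L = 0.
Hypothesis Q_hits : forall k (B : {set 'I_n}), k < L -> b <= #|B| ->
  #|[set i | [disjoint Q k i & B]]| <= u k.+1.

Definition undecided (k : nat) : {set 'I_n} :=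
  [set i | live (probe_end + k.*2) i && ~~ active (state_at (probe_end + k.*2) i)].

Lemma card_undecided k : k <= L -> #|undecided k| <= u k.
Proof.
case: k => [|k] ltk.
  by rewrite (leq_trans _ u0) // (leq_trans (max_card _)) // card_ord.
apply: leq_trans (Q_hits ltk (correct_survivors (leqnn L))).
apply/subset_leq_card/subsetP => i; rewrite inE doubleS !addnS => /andP[lr act].
by rewrite inE; apply: undecided_misses.
Qed.

Lemma correct_decides i : i \in correct ->
  clock (state_at query_end i) = query_end /\ active (state_at query_end i).
Proof.
move=> Ci; have li := live_correct query_end Ci; split; first by rewrite clock_state_at // minnn.
have := card_undecided (leqnn L); rewrite uL leqn0 cards_eq0 => /eqP/setP/(_ i).
by rewrite !inE li /= => /negbT; rewrite negbK.
Qed.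

(** * Message count *)

Definition mails (r : nat) : {set 'I_n * 'I_n} :=
  [set p | mail r p.1 p.2 != None].

Lemma mails_late r : query_end <= r -> mails r = set0.
Proof.
move=> ler; apply/setP => p; rewrite !inE; case Em: mail => [c|//].
by case/mailP: Em => _; lia.
Qed.

(** The senders of a round are exactly newly informed nodes, so the arcs used in different rounds
    are disjoint and the total is bounded by a number of arcs, without a factor for the rounds. *)
Lemma flood_mails k : k <= flood_end ->
  \sum_(0 <= r < k) #|mails r| <=
    #|[set p : 'I_n * 'I_n | E p.1 p.2 && (p.1 \in ones_before k)]|.
Proof.
elim: k => [|k IHk] ltk; first by rewrite big_geq.
rewrite big_nat_recr //=; apply: leq_trans (leq_add (IHk (ltnW ltk)) (leqnn _)) _.
rewrite -cardsUI [X in _ + X](_ : _ = 0) ?addn0.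
  apply/subset_leq_card/subsetP => p; rewrite 3!inE.
  case/orP => [/andP[-> +]|].
    by case: k ltk {IHk} => [|k] ltk; [rewrite inE|apply/subsetP/flood_mono/ltnW].
  by rewrite inE; case Em: mail => [c|//] _; case/flood_mail: Em => // -> _ _ ->.
apply/eqP; rewrite cards_eq0 -subset0; apply/subsetP => p; rewrite !inE.
case/andP => /andP[_ Pp]; case Em: mail => [c|//] _.
by case/flood_mail: Em => // _; rewrite Pp.
Qed.

Lemma probe_mails k : k < L ->
  #|mails (flood_end + k)| <= \sum_j \sum_c #|h c j|.
Proof.
move=> ltk; pose S := [set p : 'I_n * 'I_n | [exists c, p.2 \in h c p.1]].
have swap_inj : injective (fun p : 'I_n * 'I_n => (p.2, p.1)) by move=> [? ?] [? ?] [-> ->].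
apply: (@leq_trans #|S|).
  rewrite -(card_imset (mem (mails _)) swap_inj); apply/subset_leq_card/subsetP => q.
  case/imsetP => -[i j]; rewrite !inE /=; case Em: mail => [c|//] _ ->.
  by case/probe_mail: Em => // _ [c' hc]; apply/existsP; exists c'.
rewrite (card_pairs (fun j i => [exists c, i \in h c j])); apply: leq_sum => j _.
apply: (@leq_trans #|\bigcup_c h c j|).
  apply/subset_leq_card/subsetP => i; rewrite inE => /existsP[c hc].
  by apply/bigcupP; exists c.
exact: card_bigcup_le.
Qed.

Variables (cE ch : nat) (dQ : nat -> nat).
Hypothesis E_le : #|[set p : 'I_n * 'I_n | E p.1 p.2]| <= cE.
Hypothesis h_le : \sum_j \sum_c #|h c j| <= ch.
Hypothesis Q_le : forall k i, #|Q k i| <= dQ k.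

Lemma query_mails k : k < L -> #|mails (probe_end + k.*2)| <= u k * dQ k.
Proof.
move=> ltk; have lt3 : probe_end + k.*2 < query_end by rewrite /query_end; lia.
rewrite (card_pairs (fun i j => mail (probe_end + k.*2) i j != None)).
apply: leq_trans (leq_mul (card_undecided (ltnW ltk)) (leqnn _)).
rewrite -sum_nat_const [X in _ <= X]big_mkcond; apply: leq_sum => i _.
have sub j : mail (probe_end + k.*2) i j != None -> i \in undecided k /\ j \in Q k i.
  case Em: mail => [c|//] _; case/mailP: Em => lr _ ck.
  rewrite /sends ck !ltnNge leq_addr /= addKn odd_double doubleK name_state_at.
  have -> : flood_end <= probe_end + k.*2 by rewrite /probe_end; lia.
  by case/andP=> act Qj _; rewrite inE lr act.
case: ifP => [_|nU].
  by apply: leq_trans (Q_le k i); apply/subset_leq_card/subsetP => j; rewrite inE => /sub[].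
rewrite leqn0 cards_eq0 -subset0; apply/subsetP => j; rewrite inE => /sub[].
by rewrite nU.
Qed.

(** Reversing a reply gives a query of the preceding round. *)
Lemma reply_mails k : k < L ->
  #|mails (probe_end + k.*2.+1)| <= #|mails (probe_end + k.*2)|.
Proof.
move=> ltk; have swap_inj : injective (fun p : 'I_n * 'I_n => (p.2, p.1)).
  by move=> [? ?] [? ?] [-> ->].
rewrite -(card_imset (mem (mails _)) swap_inj); apply/subset_leq_card/subsetP => q.
case/imsetP => -[i j]; rewrite !inE /=; case Em: mail => [c|//] _ -> /=.
case/mailP: Em => lr lt3 ck; rewrite /sends ck addKn /= odd_double !ltnNge leq_addr.
have -> : flood_end <= probe_end + k.*2.+1 by rewrite /probe_end; lia.
case/andP => _; rewrite addnS in lr lt3 *; rewrite state_at_step ?(ltnW lt3) //=.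
by rewrite inE.
Qed.

Lemma messages_le T : messages flood_probe_query F x T <=
  cE + L * ch + (\sum_(k < L) u k * dQ k).*2.
Proof.
rewrite /messages (_ : \sum_(r < T) _ = \sum_(0 <= r < T) #|mails r|); last first.
  by rewrite big_mkord.
have le3 : \sum_(0 <= r < T) #|mails r| <= \sum_(0 <= r < query_end) #|mails r|.
  have [leT|ltT] := leqP T query_end; first by rewrite (big_cat_nat _ leT) //= leq_addr.
  rewrite (big_cat_nat _ (ltnW ltT)) //= [X in _ + X](_ : _ = 0) ?addn0 //.
  by rewrite big_nat big1 // => r /andP[ler _]; rewrite mails_late // cards0.
apply: leq_trans le3 _.
have le12 : flood_end <= probe_end by rewrite /probe_end; lia.
have le23 : probe_end <= query_end by rewrite /query_end; lia.
rewrite (big_cat_nat _ le23) // (big_cat_nat _ le12) //=; apply: leq_add; first apply: leq_add.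
- apply: leq_trans (flood_mails (leqnn _)) (leq_trans _ E_le).
  by apply/subset_leq_card/subsetP => p; rewrite !inE => /andP[].
- rewrite -{1}[flood_end]add0n big_addn /probe_end addKn.
  rewrite -[L in ones in _ <= ones]subn0 -sum_nat_const_nat big_nat [X in _ <= X]big_nat.
  apply: leq_sum => k /andP[_ ltk]; rewrite addnC.
  exact: leq_trans (probe_mails ltk) h_le.
rewrite -{1}[probe_end]add0n big_addn /query_end addKn sum_double -muln2 big_distrl /= big_mkord.
apply: leq_sum => k _; rewrite muln2 -[X in _ <= X]addnn ![_ + probe_end]addnC.
by rewrite leq_add ?(leq_trans (reply_mails _)) ?query_mails.
Qed.

(** * The consensus conditions *)

Lemma validity_fpq : validity flood_probe_query F x.
Proof.
move=> r i c; rewrite /decides /=; case: ifP => // _ [<-]; exact: bit_input.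
Qed.

Lemma agreement_fpq : agreement flood_probe_query F x.
Proof.
have /card_gt0P[k0] := leq_trans b_gt0 (correct_survivors (leqnn L)).
rewrite in_setI => /andP[_ sk0].
have bitE r i c : decides flood_probe_query F x r i c -> c = bit (state_at probe_end k0).
  rewrite /decides /= -/(state_at r); case: ifP => // /andP[ck act] [<-].
  exact: decided_bit.
by move=> r r' i j c c' /bitE-> /bitE->.
Qed.

Lemma irrevocability_fpq : irrevocability flood_probe_query F x.
Proof.
move=> r i c; rewrite /decides [decision _]/= [decision _]/= -/(state_at r) -/(state_at r.+1).
case: ifP => // /andP[ck act] [<-].
by have [-> -> ->] := active_next ck act.
Qed.

Lemma all_halted_fpq : all_halted flood_probe_query F x query_end.
Proof.
by move=> i nf /=; rewrite -/(state_at query_end) (proj1 (correct_decides _)) // in_setC.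
Qed.

Lemma termination_fpq : termination flood_probe_query F x.
Proof.
move=> i nf; have [|ck act] := @correct_decides i; first by rewrite in_setC.
exists query_end; split; last exact: all_halted_fpq.
exists (bit (state_at query_end i)); rewrite /decides /= -/(state_at query_end) ck act.
by rewrite /query_end leq_addr.
Qed.

End Execution.

End FloodProbeQuery.

(** * Random graphs *)

Lemma card_sets (T : finType) : #|{: {set T}}| = 2 ^ #|T|.
Proof. by have := card_powerset [set: T]; rewrite powersetT !cardsT. Qed.

(** Independence: a uniformly random function maps [X] into [C] with probability (|C| / |V|)^|X|. *)
Lemma card_ffun_restrict (T V : finType) (X : {set T}) (C : {set V}) :
  #|[set g : {ffun T -> V} | [forall x in X, g x \in C]]| * #|V| ^ #|X| =
  #|C| ^ #|X| * #|{ffun T -> V}|.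
Proof.
pose Fam x : {set V} := if x \in X then C else [set: V].
have -> : #|[set g : {ffun T -> V} | [forall x in X, g x \in C]]| = #|family Fam|.
  apply: eq_card => g; rewrite inE; apply/forallP/familyP => H x.
    by have := H x; rewrite /Fam; case: ifP => //= _ _; rewrite inE.
  by apply/implyP => Xx; have := H x; rewrite /Fam Xx.
rewrite card_family card_ffun foldrE big_image /=.
rewrite (bigID (mem X)) /= (eq_bigr (fun=> #|C|)); last by move=> x; rewrite /Fam => ->.
rewrite [X in _ * X * _](eq_bigr (fun=> #|V|)); last first.
  by move=> x; rewrite /Fam => /negbTE->; rewrite cardsT.
rewrite !prod_nat_const -mulnA -expnD addnC; congr (_ * _ ^ _).
by rewrite -(cardC (mem X)).
Qed.

Section Rows.

Variables (n d : nat).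

Local Notation row := {ffun 'I_d -> 'I_n}.

Definition out (r : row) : {set 'I_n} := [set r k | k : 'I_d].

Lemma card_out r : #|out r| <= d.
Proof. by rewrite (leq_trans (leq_imset_card _ _)) // card_ord. Qed.

Lemma card_row : #|{: row}| = n ^ d.
Proof. by rewrite card_ffun !card_ord. Qed.

Lemma card_miss (B : {set 'I_n}) :
  #|[set r : row | [disjoint out r & B]]| = (n - #|B|) ^ d.
Proof.
have -> : n - #|B| = #|~: B| by have := cardsC B; rewrite card_ord; lia.
transitivity #|[pred r : row | r \in ffun_on (mem (~: B))]|; last first.
  by rewrite card_ffun_on card_ord.
apply: eq_card => r; rewrite !inE.
apply/pred0P/ffun_onP => [H k|H j /=].
  by rewrite inE; apply/negP => Bk; have := H (r k); rewrite /= /out imset_f // Bk.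
by apply/negP => /andP[/imsetP[k _ ->]]; have := H k; rewrite inE => /negP.
Qed.

(** Union bound over the [d] entries, each of which falls into [B] with probability |B| / n. *)
Lemma card_hit (B : {set 'I_n}) :
  #|[set r : row | ~~ [disjoint out r & B]]| * n <= d * #|B| * n ^ d.
Proof.
pose S k := [set r : row | [forall x in [set k], r x \in B]].
have cS k : #|S k| * n = #|B| * n ^ d.
  by have := card_ffun_restrict [set k] B; rewrite cards1 !expn1 card_ord card_row.
apply: (@leq_trans (#|\bigcup_k S k| * n)).
  rewrite leq_mul2r; apply/orP; right; apply/subset_leq_card/subsetP => r.
  rewrite inE => /pred0Pn[j /andP[/= /imsetP[k _ ->] Bk]]; apply/bigcupP; exists k => //.
  by rewrite inE; apply/forallP => y; apply/implyP; rewrite inE => /eqP->.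
apply: (@leq_trans ((\sum_k #|S k|) * n)); first by rewrite leq_mul2r card_bigcup_le orbT.
rewrite big_distrl /= (eq_bigr (fun=> #|B| * n ^ d)) => [|k _]; last exact: cS.
by rewrite sum_nat_const card_ord mulnA.
Qed.

End Rows.

(** This is (1 - b/n)^k <= 2^(-e): by Bernoulli's inequality every [c] factors contribute at most
    1/2. *)
Lemma pow_halves n b c e k : 0 < n -> n <= c * b -> b <= n -> c * e <= k ->
  2 ^ e * (n - b) ^ k <= n ^ k.
Proof.
move=> n_gt0 le_n le_b le_k.
have half : 2 * (n - b) ^ c <= n ^ c.
  case: c le_n {le_k} => [|c] le_n; first by lia.
  have bern y : y ^ c.+1 + c.+1 * b * y ^ c <= (y + b) ^ c.+1.
    elim: (c) => [|c' IH]; first by rewrite !expn1 expn0; lia.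
    rewrite expnS [X in _ <= X]expnS; apply: leq_trans (leq_mul (leqnn (y + b)) IH).
    rewrite (expnS y c'); set z := y ^ c'; nia.
  have := bern (n - b); rewrite subnK //; apply: leq_trans.
  rewrite expnS; set z := (n - b) ^ c; nia.
rewrite -(subnKC le_k) !expnD mulnA leq_mul //; last first.
  by case: (k - _) => // k'; rewrite leq_exp2r ?leq_subr.
by rewrite !expnM -expnMn; elim: e {le_k} => // e IHe; rewrite !expnS leq_mul.
Qed.

Section RobustFamilies.

Variables (J : finType) (n d c b w : nat).

Local Notation graphs := {ffun J * 'I_n -> {ffun 'I_d -> 'I_n}}.

Definition fragile : {set graphs} :=
  [set g : graphs | [exists j : J, exists U : {set 'I_n}, exists B : {set 'I_n},
     [&& w <= #|U|, b <= #|B| & [forall i in U, [disjoint out (g (j, i)) & B]]]]].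

(** Each triple of [j], [U], [B] has probability at most 2^(-3n), and there are 4^n pairs of sets,
    which leaves |J| 2^(-n). *)
Lemma card_fragile : 0 < n -> n <= c * b -> c * (3 * n) <= d * w ->
  #|fragile| * 2 ^ n <= #|J| * #|{: graphs}|.
Proof.
move=> n_gt0 le_n le_w.
pose S j (U B : {set 'I_n}) : {set graphs} :=
  [set g : graphs | [forall x in [set (j, i) | i in U],
              g x \in [set r : {ffun 'I_d -> 'I_n} | [disjoint out r & B]]]].
have cS j (U B : {set 'I_n}) : w <= #|U| -> b <= #|B| ->
    #|S j U B| * 2 ^ (3 * n) <= #|{: graphs}|.
  move=> leU leB; have := card_ffun_restrict [set (j, i) | i in U]
    [set r : {ffun 'I_d -> 'I_n} | [disjoint out r & B]].
  rewrite -/(S j U B) card_miss card_imset; last by move=> i i' [].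
  rewrite card_row -!expnM; set tot := #|{: graphs}| => cE.
  have := @pow_halves n #|B| c (3 * n) (d * #|U|) n_gt0.
  rewrite (leq_trans le_n) ?leq_mul2l ?leB ?orbT // => /(_ isT).
  rewrite (leq_trans (max_card _)) ?card_ord // => /(_ isT).
  rewrite (leq_trans le_w) ?leq_mul2l ?leU ?orbT // => /(_ isT) le_pow.
  have p_gt0 : 0 < n ^ (d * #|U|) by rewrite expn_gt0 n_gt0.
  by rewrite -(leq_pmul2r p_gt0) mulnAC cE mulnAC [X in _ <= X]mulnC leq_mul // mulnC.
pose F j := \bigcup_(U : {set 'I_n} | w <= #|U|)
  \bigcup_(B : {set 'I_n} | b <= #|B|) S j U B.
have cF : #|\bigcup_j F j| * 2 ^ (3 * n) <= #|J| * (2 ^ n * (2 ^ n * #|{: graphs}|)).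
  apply: leq_trans (leq_mul (card_bigcup_le _ _) (leqnn _)) _.
  rewrite big_distrl -sum_nat_const; apply: leq_sum => j _ /=.
  apply: leq_trans (leq_mul (card_bigcup_le _ _) (leqnn _)) _.
  have cset : #|{: {set 'I_n}}| = 2 ^ n by rewrite card_sets card_ord.
  rewrite big_distrl -{1}cset -sum_nat_const big_mkcond; apply: leq_sum => U _ /=.
  case: ifP => // leU.
  apply: leq_trans (leq_mul (card_bigcup_le _ _) (leqnn _)) _.
  rewrite big_distrl -cset -sum_nat_const big_mkcond; apply: leq_sum => B _ /=.
  by case: ifP => // leB; apply: cS.
have p_gt0 : 0 < 2 ^ n * 2 ^ n by rewrite muln_gt0 !expn_gt0.
rewrite -(leq_pmul2r p_gt0).
have -> : #|fragile| * 2 ^ n * (2 ^ n * 2 ^ n) = #|fragile| * 2 ^ (3 * n).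
  by rewrite -mulnA -!expnD; congr (_ * _ ^ _); lia.
apply: (@leq_trans (#|\bigcup_j F j| * 2 ^ (3 * n))); last first.
  by apply: leq_trans cF _; rewrite !mulnA; apply: eq_leq; ring.
rewrite leq_mul2r; apply/orP; right; apply/subset_leq_card/subsetP => g.
rewrite inE => /existsP[j /existsP[U /existsP[B /and3P[leU leB /forallP H]]]].
apply/bigcupP; exists j => //; apply/bigcupP; exists U => //.
apply/bigcupP; exists B => //; rewrite inE; apply/forallP => y; apply/implyP.
by case/imsetP => i Ui ->; rewrite inE; apply: (implyP (H i)).
Qed.

Lemma not_fragileP g : g \notin fragile -> forall j (B : {set 'I_n}), b <= #|B| ->
  #|[set i | [disjoint out (g (j, i)) & B]]| < w.
Proof.
rewrite inE => /existsPn/(_ _)/existsPn H j B leB; rewrite ltnNge; apply/negP => leU.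
have /existsPn/(_ B) := H j [set i | [disjoint out (g (j, i)) & B]].
by rewrite leU leB /=; apply/negP; rewrite negbK; apply/forallP => i; apply/implyP; rewrite inE.
Qed.

End RobustFamilies.

(** The falling factorial of 2k of length k is at least k^k and equals k! times a binomial
    coefficient, which is at most 4^k. *)
Lemma exp_self_le_fact k : k ^ k <= 4 ^ k * k`!.
Proof.
have le_ff : k ^ k <= k.*2 ^_ k.
  rewrite ffact_prod -{2}(card_ord k) -prod_nat_const; apply: leq_prod => i _.
  by have := ltn_ord i; lia.
apply: leq_trans le_ff _; rewrite -bin_ffact leq_mul2r; apply/orP; right.
rewrite -[X in 'C(X, _)](card_ord k.*2) -card_draws (leq_trans (max_card _)) //.
by rewrite card_sets card_ord -muln2 mulnC expnM.
Qed.

Lemma bin_exp_le n k : 'C(n, k) * k ^ k <= 4 ^ k * n ^ k.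
Proof.
apply: leq_trans (leq_mul (leqnn _) (exp_self_le_fact k)) _.
rewrite mulnCA leq_mul2l bin_ffact ffact_prod; apply/orP; right.
have -> : n ^ k = \prod_(i < k) n by rewrite prod_nat_const card_ord.
by apply: leq_prod => i _; apply: leq_subr.
Qed.

Lemma small_set_bound n d a : 0 < a -> 16 * a * d ^ 2 <= n ->
  'C(n, a) * 'C(n, a.*2) * (d * a.*2) ^ (6 * a) * 4 ^ a <= n ^ (6 * a).
Proof.
move=> a_gt0 le_n.
have p_gt0 : 0 < a ^ a * a.*2 ^ a.*2 by rewrite muln_gt0 !expn_gt0 double_gt0 a_gt0.
rewrite -(leq_pmul2r p_gt0).
have -> : 'C(n, a) * 'C(n, a.*2) * (d * a.*2) ^ (6 * a) * 4 ^ a * (a ^ a * a.*2 ^ a.*2) =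
   ('C(n, a) * a ^ a) * ('C(n, a.*2) * a.*2 ^ a.*2) * ((d * a.*2) ^ (6 * a) * 4 ^ a).
  by ring.
apply: leq_trans (leq_mul (leq_mul (bin_exp_le n a) (bin_exp_le n a.*2)) (leqnn _)) _.
have expd y : y ^ a.*2 = (y ^ 2) ^ a by rewrite -mul2n expnM.
have exp6 y : y ^ (6 * a) = (y ^ 6) ^ a by rewrite expnM.
rewrite !expd !exp6 -!expnMn leq_exp2r //.
(* After binomials are bounded by (4n/k)^k and a-th roots are taken, the claim is the cube of the
   hypothesis times 4 a^3 n^3. *)
have cube : (16 * a * d ^ 2) ^ 3 <= n ^ 3 by rewrite leq_exp2r.
apply: (@leq_trans (n ^ 3 * (4 * a ^ 3) * (16 * a * d ^ 2) ^ 3)).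
  by apply: eq_leq; rewrite -mul2n; ring.
apply: (@leq_trans (n ^ 3 * (4 * a ^ 3) * n ^ 3)); first by rewrite leq_mul2l cube orbT.
by apply: eq_leq; rewrite -mul2n; ring.
Qed.

Lemma geometric_sum_le (N : nat -> nat) tot s :
  (forall a, 0 < a <= s -> N a * 4 ^ a <= tot) -> 3 * \sum_(a < s) N a.+1 <= tot.
Proof.
(* Partial geometric sums: the strengthened claim says 3 S <= (1 - 4^(-s)) tot. *)
move=> leN; suff: 3 * 4 ^ s * \sum_(a < s) N a.+1 + tot <= 4 ^ s * tot.
  have : 0 < 4 ^ s by rewrite expn_gt0.
  set p := 4 ^ s; set S := \sum_(a < s) _ => p_gt0 H.
  by rewrite -(leq_pmul2l p_gt0); nia.
elim: s leN => [|s IHs] leN; first by rewrite big_ord0; lia.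
have /IHs : forall a, 0 < a <= s -> N a * 4 ^ a <= tot by move=> a Ha; apply: leN; lia.
rewrite big_ord_recr /=; have := leN s.+1; rewrite ltnS leqnn => /(_ isT).
rewrite expnS; set p := 4 ^ s; set S := \sum_(a < s) _; set y := N _; nia.
Qed.

Lemma subset_of_card (T : finType) (B : {set T}) k : #|B| <= k <= #|T| ->
  exists2 B' : {set T}, B \subset B' & #|B'| = k.
Proof.
case/andP=> /subnKC <-; elim: (k - #|B|) => [|i IHi] le_k; first by exists B; rewrite ?addn0.
have [|B' sB cB] := IHi; first by lia.
have /set0Pn[y] : ~: B' != set0 by rewrite -card_gt0; have := cardsC B'; lia.
rewrite inE => yB; exists (y |: B'); first exact: subset_trans (subsetUr _ _).
by rewrite cardsU1 yB cB; lia.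
Qed.

Section Expanders.

Variables (n d s : nat).

Local Notation graphs := {ffun 'I_6 * 'I_n -> {ffun 'I_d -> 'I_n}}.

(* For fixed d, and up to factors exponential in a, there are (n/a)^(3a)      *)
(* choices of A and B, against a probability (a/n)^(6a) of the 6a hits.       *)
Definition trapping (a : nat) : {set graphs} :=
  [set g : graphs | [exists A : {set 'I_n}, exists B : {set 'I_n},
     [&& #|A| == a, #|B| == a.*2 &
         [forall x in setX setT A, ~~ [disjoint out (g x) & B]]]]].

Lemma card_trapping a : 0 < a -> 16 * a * d ^ 2 <= n ->
  #|trapping a| * 4 ^ a <= #|{: graphs}|.
Proof.
move=> a_gt0 le_n; set tot := #|{: graphs}|.
have [n0|n_gt0] := posnP n.
  suff -> : trapping a = set0 by rewrite cards0.
  apply/setP => g; rewrite in_set in_set0; apply/negbTE/negP => /existsP[A /existsP[B /and3P[/eqP cA _ _]]].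
  by have := max_card (mem A); rewrite cA card_ord; lia.
pose S (A B : {set 'I_n}) : {set graphs} :=
  [set g : graphs | [forall x in setX setT A,
            g x \in [set r : {ffun 'I_d -> 'I_n} | ~~ [disjoint out r & B]]]].
have cS (A B : {set 'I_n}) : #|A| == a -> #|B| == a.*2 ->
    #|S A B| * n ^ (6 * a) <= (d * a.*2) ^ (6 * a) * tot.
  move=> /eqP cA /eqP cB.
  have := card_ffun_restrict (setX [set: 'I_6] A)
    [set r : {ffun 'I_d -> 'I_n} | ~~ [disjoint out r & B]].
  rewrite -/(S A B) -/tot cardsX cardsT card_ord cA card_row.
  have := @card_hit n d B; rewrite cB; set H := #|_| => leH cE.
  have p_gt0 : 0 < (n ^ d) ^ (6 * a) by rewrite !expn_gt0 n_gt0.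
  rewrite -(leq_pmul2r p_gt0) mulnAC cE mulnAC [X in _ <= X]mulnAC leq_mul //.
  by rewrite -!expnMn leq_exp2r // muln_gt0.
have p_gt0' : 0 < n ^ (6 * a) by rewrite expn_gt0 n_gt0.
rewrite -(leq_pmul2r p_gt0').
apply: (@leq_trans ('C(n, a) * 'C(n, a.*2) * (d * a.*2) ^ (6 * a) * 4 ^ a * tot)); last first.
  by rewrite [X in _ <= X]mulnC leq_mul // small_set_bound.
have -> : 'C(n, a) * 'C(n, a.*2) * (d * a.*2) ^ (6 * a) * 4 ^ a * tot =
   'C(n, a) * ('C(n, a.*2) * ((d * a.*2) ^ (6 * a) * tot)) * 4 ^ a by ring.
rewrite mulnAC leq_mul //.
have sub : trapping a \subset \bigcup_(A : {set 'I_n} | #|A| == a)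
    \bigcup_(B : {set 'I_n} | #|B| == a.*2) S A B.
  apply/subsetP => g; rewrite inE => /existsP[A /existsP[B /and3P[cA cB H]]].
  apply/bigcupP; exists A => //; apply/bigcupP; exists B => //; rewrite inE.
  apply/forallP => y; apply/implyP => Ay; rewrite inE.
  by move/forallP/(_ y)/implyP: H; apply.
apply: leq_trans (leq_mul (subset_leq_card sub) (leqnn _)) _.
apply: leq_trans (leq_mul (card_bigcup_le _ _) (leqnn _)) _.
have draws k : 'C(n, k) = #|[pred A : {set 'I_n} | #|A| == k]|.
  by rewrite -[n in LHS]card_ord -card_draws; apply: eq_card => A; rewrite !inE.
rewrite big_distrl {1}draws -sum_nat_const; apply: leq_sum => A cA /=.
apply: leq_trans (leq_mul (card_bigcup_le _ _) (leqnn _)) _.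
rewrite big_distrl draws -sum_nat_const; apply: leq_sum => B cB /=.
exact: cS.
Qed.

(** A violating [B] has fewer than 2|A| elements and is padded to exactly 2|A|, for which
    [2 * s <= n] leaves room. *)
Lemma not_trappingP (g : graphs) : 2 * s <= n ->
  (forall a, 0 < a < s -> g \notin trapping a) ->
  forall A B : {set 'I_n}, 0 < #|A| < s ->
  (forall i, i \in A -> forall c, exists2 j, j \in out (g (c, i)) & j \in B) ->
  #|A|.*2 <= #|B|.
Proof.
move=> le_n ng A B cA hit; rewrite leqNgt; apply/negP => ltB.
have [|B' sB cB] := @subset_of_card _ B #|A|.*2; first by rewrite card_ord; lia.
have /negP[] := ng _ cA; rewrite inE; apply/existsP; exists A; apply/existsP; exists B'.
rewrite eqxx cB eqxx; apply/forallP => -[c i]; apply/implyP; rewrite !inE /= => Ai.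
have [j oj Bj] := hit i Ai c; apply/pred0Pn; exists j.
by rewrite /= oj (subsetP sB).
Qed.

End Expanders.

(** * Overlays and parameters *)

Lemma exists_notin (T : finType) (S : {set T}) : #|S| < #|T| -> exists y, y \notin S.
Proof.
rewrite -cardsT => ltS; have /set0Pn[y] : ~: S != set0.
  by rewrite -card_gt0; have := cardsC S; rewrite cardsT in ltS; lia.
by rewrite inE => yS; exists y.
Qed.

Lemma robust_graph n d c b w : 0 < n -> n <= c * b -> c * (3 * n) <= d * w ->
  exists2 G : 'I_n -> {set 'I_n}, (forall i, #|G i| <= d) &
  forall B : {set 'I_n}, b <= #|B| -> #|[set i | [disjoint G i & B]]| < w.
Proof.
move=> n_gt0 le_n le_w; have le_bad := card_fragile unit n_gt0 le_n le_w.
have [|g ng] := @exists_notin _ (fragile unit n d b w).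
  have tot_gt0 : 0 < #|{: {ffun unit * 'I_n -> {ffun 'I_d -> 'I_n}}}|.
    by rewrite card_ffun card_row !expn_gt0 n_gt0.
  have two : 2 <= 2 ^ n by rewrite -{1}(expn1 2) leq_exp2l.
  move: le_bad tot_gt0; rewrite card_unit mul1n.
  set bad := #|_|; set tot := #|_|; set p := 2 ^ n in two *; nia.
exists (fun i => out (g (tt, i))) => [i|B leB]; first exact: card_out.
exact: not_fragileP ng tt B leB.
Qed.

Lemma expander_family n d s c b w : 5 <= n -> n <= c * b -> c * (3 * n) <= d * w ->
  0 < d -> 16 * s * d ^ 2 <= n ->
  exists h : 'I_6 -> 'I_n -> {set 'I_n}, [/\ forall j i, #|h j i| <= d,
    forall A B : {set 'I_n}, 0 < #|A| < s ->
      (forall i, i \in A -> forall j, exists2 y, y \in h j i & y \in B) ->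
      #|A|.*2 <= #|B|
  & forall B : {set 'I_n}, b <= #|B| ->
      #|[set i | [exists j, [disjoint h j i & B]]]| <= 6 * w].
Proof.
move=> n_ge5 le_n le_w d_gt0 le_s; have n_gt0 : 0 < n by lia.
have le_bad := card_fragile 'I_6 n_gt0 le_n le_w.
pose S := fragile 'I_6 n d b w :|: \bigcup_(a < s) trapping n d a.+1.
have [|g ng] := @exists_notin _ S.
  have tot_gt0 : 0 < #|{: {ffun 'I_6 * 'I_n -> {ffun 'I_d -> 'I_n}}}|.
    by rewrite card_ffun card_row !expn_gt0 n_gt0.
  (* The failure probabilities are at most 6/32 for robustness and 1/3 for expansion, with sum below
     1. *)
  have p32 : 32 <= 2 ^ n by rewrite -[32]/(2 ^ 5) leq_exp2l.
  have := @geometric_sum_le (fun a => #|trapping n d a|)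
    #|{: {ffun 'I_6 * 'I_n -> {ffun 'I_d -> 'I_n}}}| s.
  have leT a : 0 < a <= s ->
      #|trapping n d a| * 4 ^ a <= #|{: {ffun 'I_6 * 'I_n -> {ffun 'I_d -> 'I_n}}}|.
    case/andP=> a_gt0 le_a; apply: card_trapping => //; apply: leq_trans le_s.
    by rewrite !leq_mul.
  move/(_ leT); have := card_bigcup_le predT (fun a : 'I_s => trapping n d a.+1).
  have := leq_card_setU (fragile 'I_6 n d b w) (\bigcup_(a < s) trapping n d a.+1).
  rewrite -/S; move: le_bad tot_gt0; rewrite card_ord.
  set bad1 := #|fragile _ _ _ _ _|; set tot := #|{: _}|; set cS := #|S|.
  set bad2 := #|\bigcup_(a < s) _|; set sum := \sum_(a < s) _; set p := 2 ^ n in p32 *.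
  move=> le1 tot_gt0 [leS _] le2 le3; have: bad1 * 32 <= 6 * tot by nia.
  by lia.
move: ng; rewrite in_setU negb_or => /andP[nf nt].
exists (fun j i => out (g (j, i))); split=> [j i||B leB]; first exact: card_out.
  apply: not_trappingP; first by nia.
  case=> // a /andP[_ lt_a]; apply: contra nt => ta; apply/bigcupP.
  by exists (Ordinal (ltnW lt_a)).
apply: (@leq_trans #|\bigcup_j [set i | [disjoint out (g (j, i)) & B]]|).
  apply/subset_leq_card/subsetP => i; rewrite inE => /existsP[j Hj].
  by apply/bigcupP; exists j => //; rewrite inE.
apply: leq_trans (card_bigcup_le _ _) _.
rewrite -[6 in X in _ <= X]card_ord -sum_nat_const; apply: leq_sum => j _.
exact/ltnW/(not_fragileP nf).
Qed.

Lemma card_symmetric_closure n D (N : 'I_n -> {set 'I_n}) : (forall i, #|N i| <= D) ->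
  #|[set p : 'I_n * 'I_n | (p.2 \in N p.1) || (p.1 \in N p.2)]| <= 2 * (n * D).
Proof.
move=> leN; pose S := [set p : 'I_n * 'I_n | p.2 \in N p.1].
have cS : #|S| <= n * D.
  rewrite (card_pairs (fun i j => j \in N i)) -[n in n * D]card_ord -sum_nat_const.
  by apply: leq_sum => i _; rewrite cardsE.
pose swap (p : 'I_n * 'I_n) := (p.2, p.1).
apply: (@leq_trans #|S :|: swap @: S|).
  apply/subset_leq_card/subsetP => -[i j]; rewrite !inE /= => /orP[->//|Nji].
  by apply/orP; right; apply/imsetP; exists (j, i); rewrite // inE.
apply: leq_trans (leq_card_setU _ _) _; rewrite mul2n -addnn leq_add //.
exact: leq_trans (leq_imset_card _ _) cS.
Qed.

Definition solves_within n (A : protocol n) (t rounds msgs : nat) : Prop :=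
  forall (F : adversary n) (x : 'I_n -> bool), #|faulty F| <= t ->
  [/\ [/\ validity A F x, agreement A F x, irrevocability A F x & termination A F x],
      all_halted A F x rounds
    & forall T, messages A F x T <= msgs].

Lemma flood_probe_query_solves n delta L (E : rel 'I_n)
    (h : 'I_delta -> 'I_n -> {set 'I_n}) (Q : nat -> 'I_n -> {set 'I_n})
    t s b v u cE ch dQ :
  symmetric E -> (forall c i j, j \in h c i -> E i j) ->
  (forall A B : {set 'I_n}, s <= #|A| -> s <= #|B| ->
     exists i j, [/\ i \in A, j \in B & (i == j) || E i j]) ->
  (forall A B : {set 'I_n}, 0 < #|A| < s ->
     (forall i, i \in A -> forall c, exists2 j, j \in h c i & j \in B) ->
     #|A|.*2 <= #|B|) ->
  s <= 2 ^ L -> 0 < L -> 0 < b -> b + v <= n - t ->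
  (forall B : {set 'I_n}, b <= #|B| ->
     #|[set i | [exists c, [disjoint h c i & B]]]| <= v) ->
  n <= u 0 -> u L = 0 ->
  (forall k (B : {set 'I_n}), k < L -> b <= #|B| ->
     #|[set i | [disjoint Q k i & B]]| <= u k.+1) ->
  #|[set p : 'I_n * 'I_n | E p.1 p.2]| <= cE ->
  \sum_j \sum_c #|h c j| <= ch -> (forall k i, #|Q k i| <= dQ k) ->
  solves_within (flood_probe_query L E h Q) t (n.-1 + L + L.*2)
    (cE + L * ch + (\sum_(k < L) u k * dQ k).*2).
Proof.
move=> Es hE El hx leL L0 b0 leM hr u0 uL Qh Ele hle Qle F x leF.
have leC : b + v <= #|correct F|.
  by have := cardsC (faulty F); rewrite card_ord /correct; lia.
split; [split|..].
- exact: validity_fpq.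
- exact: (agreement_fpq Es hE El hx leL leC b0 hr L0).
- exact: irrevocability_fpq.
- exact: (termination_fpq E x leL leC b0 hr L0 u0 uL Qh).
- exact: (all_halted_fpq E x leL leC b0 hr L0 u0 uL Qh).
- exact: (messages_le x leL leC b0 hr L0 u0 uL Qh Ele hle Qle).
Qed.

(* With no probing blocks and a complete overlay the protocol is plain        *)
(* flooding.                                                                  *)
Lemma dense_protocol n t L : t < n -> 0 < L ->
  exists A : protocol n, solves_within A t (n.-1 + L + L.*2) (3 * n ^ 2).
Proof.
move=> lt_t L_gt0; have n_gt0 : 0 < n by lia.
pose E : rel 'I_n := fun _ _ => true.
pose h (c : 'I_0) (i : 'I_n) : {set 'I_n} := set0.
pose u k := if k is 0 then n else 0.
have := @flood_probe_query_solves n 0 L E h (fun _ _ => setT) t 1 1 0 u (n ^ 2) 0 (fun=> n).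
move=> H; exists (flood_probe_query L E h (fun _ _ => setT)).
have <- : n ^ 2 + L * 0 + (\sum_(k < L) u k * n).*2 = 3 * n ^ 2.
  case: L L_gt0 {H} => // L _; rewrite big_ord_recl big1 // muln0 /= -mul2n; ring.
apply: H => //.
- move=> A B /card_gt0P[i Ai] /card_gt0P[j Bj]; exists i, j.
  by rewrite Ai Bj orbT.
- by move=> A B; lia.
- by rewrite expn_gt0.
- by lia.
- by move=> B _; rewrite leqn0 cards_eq0 -subset0; apply/subsetP => i; rewrite inE => /existsP[[]].
- by rewrite /u; case: (L) L_gt0.
- move=> k B _ /card_gt0P[j Bj]; rewrite leqn0 cards_eq0 -subset0; apply/subsetP => i.
  by rewrite inE => /pred0P/(_ j); rewrite /= inE Bj.
- by rewrite (leq_trans (max_card _)) // card_prod card_ord -mulnn.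
- by rewrite big1 // => j _; rewrite big_ord0.
- by move=> _ i; rewrite cardsT card_ord.
Qed.

Lemma sparse_protocol n t L q d : t < n -> 0 < q -> n < 2 ^ L -> n <= q * (n - t) ->
  288 * q ^ 2 <= d -> 16 * d ^ 2 <= n ->
  exists A : protocol n, solves_within A t (n.-1 + L + L.*2)
    (2 * (n * (3 * (32 * d ^ 2) ^ 2 + 6 * d)) + L * (n * (6 * d)) + L * (48 * q * n)).
Proof.
move=> lt_t q_gt0 ltL le_n le_d le16; set m := n - t in le_n *.
have d_ge : 288 <= d by nia.
have n_ge : 288 * d <= n by nia.
have n_gt0 : 0 < n by lia.
have L_gt0 : 0 < L by case: (L) ltL => //; rewrite expn0; lia.
have m_ge : 12 <= m.
  have : q * 12 <= q * m by nia.
  by rewrite leq_pmul2l.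
(* Six blocks, each missed by at most [w] nodes, give v = 6w; with b = 6w as well, b + v <= m. Up to
   size [s] the sets expand. *)
pose w := m %/ 12; pose s := n %/ (16 * d ^ 2).
have w_gt0 : 0 < w by rewrite divn_gt0.
have le12 : w * 12 <= m by apply: leq_trunc_div.
have le24 : m <= 24 * w.
  by have := divn_eq m 12; have := ltn_pmod m (isT : 0 < 12); rewrite -/w; lia.
have le_nw : n <= q * (24 * w) by apply: leq_trans le_n _; rewrite leq_mul2l le24 orbT.
have d2_gt0 : 0 < 16 * d ^ 2 by rewrite muln_gt0 expn_gt0; lia.
have s_gt0 : 0 < s by rewrite divn_gt0.
have le_s : s * (16 * d ^ 2) <= n by apply: leq_trunc_div.
have le_ns : n <= 32 * d ^ 2 * s.
  have := divn_eq n (16 * d ^ 2); have := ltn_pmod n d2_gt0; rewrite -/s.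
  by set z := d ^ 2; nia.
have [G G_le G_hit] : exists2 G : 'I_n -> {set 'I_n},
    (forall i, #|G i| <= 3 * (32 * d ^ 2) ^ 2) &
    forall B : {set 'I_n}, s <= #|B| -> #|[set i | [disjoint G i & B]]| < s.
  apply: (@robust_graph _ _ (32 * d ^ 2)) => //.
  by set z := 32 * d ^ 2 in le_ns *; rewrite -(mulnn z); nia.
have [h [h_le h_exp h_rob]] : exists h : 'I_6 -> 'I_n -> {set 'I_n},
   [/\ forall j i, #|h j i| <= d,
    forall A B : {set 'I_n}, 0 < #|A| < s ->
      (forall i, i \in A -> forall j, exists2 y, y \in h j i & y \in B) ->
      #|A|.*2 <= #|B|
  & forall B : {set 'I_n}, 6 * w <= #|B| ->
      #|[set i | [exists j, [disjoint h j i & B]]]| <= 6 * w].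
  apply: (@expander_family _ _ _ (4 * q)); [lia|lia| |lia|lia].
  (* As n <= 24 q w, the requirement 4q * 3n <= d w follows from d >= 288 q^2. *)
  apply: (@leq_trans (288 * q ^ 2 * w)); last by rewrite leq_mul2r le_d orbT.
  by rewrite -mulnn; nia.
(* The query degree doubles with [k] as the bound on undecided nodes halves, so each phase costs at
   most 24 q n queries and as many replies. *)
have /choice[Q Q_spec] k : exists G : 'I_n -> {set 'I_n},
    (forall i, #|G i| <= 12 * q * 2 ^ k.+1) /\
    forall B : {set 'I_n}, 6 * w <= #|B| -> #|[set i | [disjoint G i & B]]| <= n %/ 2 ^ k.+1.
  have [||Gk Gk_le Gk_hit] :=
    @robust_graph n (12 * q * 2 ^ k.+1) (4 * q) (6 * w) (n %/ 2 ^ k.+1).+1 n_gt0.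
  - by lia.
  - have : n <= 2 ^ k.+1 * (n %/ 2 ^ k.+1).+1.
      by rewrite mulnC ltnW // ltn_ceil // expn_gt0.
    by set p := 2 ^ k.+1; set y := _.+1; nia.
  by exists Gk; split.
pose N i := G i :|: \bigcup_c h c i.
have N_le i : #|N i| <= 3 * (32 * d ^ 2) ^ 2 + 6 * d.
  apply: leq_trans (leq_card_setU _ _) (leq_add (G_le i) _).
  apply: leq_trans (card_bigcup_le _ _) _.
  by rewrite -[6 in X in _ <= X]card_ord -sum_nat_const; apply: leq_sum.
pose E : rel 'I_n := fun i j => (j \in N i) || (i \in N j).
exists (flood_probe_query L E h Q) => F x leF.
pose u k := n %/ 2 ^ k.
have [|||||||||||||||C1 C2 C3] :=
  @flood_probe_query_solves n 6 L E h Q t s (6 * w) (6 * w) u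
  (2 * (n * (3 * (32 * d ^ 2) ^ 2 + 6 * d))) (n * (6 * d)) (fun k => 12 * q * 2 ^ k.+1)
  _ _ _ _ _ _ _ _ _ _ _ _ _ _ _ F x leF.
- by move=> i j; rewrite /E orbC.
- move=> c i j hj; apply/orP; left; rewrite inE; apply/orP; right.
  by apply/bigcupP; exists c.
- move=> A B leA leB; have := G_hit B leB; rewrite ltnNge => /negP nle.
  have /subsetPn[i Ai] : ~~ (A \subset [set i | [disjoint G i & B]]).
    by apply/negP => /subset_leq_card sA; apply: nle; apply: leq_trans sA.
  rewrite inE => /pred0Pn[j /andP[/= Gj Bj]]; exists i, j; split=> //.
  by rewrite /E inE Gj orbT.
- exact: h_exp.
- apply: leq_trans (ltnW ltL); exact: leq_div.
- exact: L_gt0.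
- by lia.
- by rewrite -/m; lia.
- exact: h_rob.
- by rewrite /u expn0 divn1.
- by rewrite /u divn_small.
- by move=> k B _ leB; apply: (proj2 (Q_spec k)).
- exact: card_symmetric_closure.
- rewrite -[n in n * _]card_ord -sum_nat_const; apply: leq_sum => j _.
  by rewrite -[6 in X in _ <= X]card_ord -sum_nat_const; apply: leq_sum.
- by move=> k i; apply: (proj1 (Q_spec k)).
split=> // T; apply: leq_trans (C3 T) _; rewrite leq_add2l -muln2 big_distrl /=.
rewrite -[L in X in _ <= X]card_ord -sum_nat_const; apply: leq_sum => k _.
have := leq_trunc_div n (2 ^ k); rewrite -/(u k) expnS.
by set p := 2 ^ k; set y := u k; nia.
Qed.

Lemma consensus_protocol : exists C : nat, forall n t, t < n ->
  exists A : protocol n, let q := (n %/ (n - t)).+1 in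
  let L := (trunc_log 2 n).+1 in
  solves_within A t (n.-1 + L + L.*2) (C * q ^ 8 * n + 1776 * q ^ 2 * L * n).
Proof.
(* [K] stays a variable so that the constants are never evaluated in unary. *)
have [K KE] : exists K, K = 288 by exists 288.
exists (2 * (3 * (32 * K ^ 2) ^ 2 + 6 * K) + 48 * K ^ 2) => n t lt_t.
set q := _.+1; set L := _.+1 => /=.
pose d := K * q ^ 2.
have le_q : n <= q * (n - t) by rewrite ltnW // ltn_ceil //; lia.
have powq i j : i <= j -> q ^ i <= q ^ j by move=> le_ij; rewrite leq_pexp2l.
have weaken (A : protocol n) r M M' : M <= M' ->
    solves_within A t r M -> solves_within A t r M'.
  move=> leM SA F x leF; case: (SA F x leF) => C1 C2 C3; split=> // T.
  by apply: leq_trans (C3 T) leM.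
have [le16|lt16] := leqP (16 * d ^ 2) n.
  have [] := @sparse_protocol n t L q d lt_t => //.
  - exact: trunc_log_ltn.
  - by rewrite /d KE.
  move=> A SA; exists A; apply: weaken SA.
  have -> : (32 * d ^ 2) ^ 2 = (32 * K ^ 2) ^ 2 * q ^ 8 by rewrite /d; ring.
  have := powq 2 8 isT; have := powq 1 2 isT; rewrite expn1 /d.
  set a := (32 * K ^ 2) ^ 2; set q2 := q ^ 2; set q8 := q ^ 8 => le_q2 le_q8.
  (* Here 1776 = 6 * 288 + 48: probing and querying together. *)
  have lin : 6 * (K * q2) + 48 * q <= 1776 * q2 by rewrite KE; lia.
  have le6 : 6 * (K * q2) <= 6 * K * q8 by rewrite mulnA leq_mul2l le_q8 orbT.
  rewrite -addnA -mulnDr [X in _ + _ * X <= _](_ : _ = n * (6 * (K * q2) + 48 * q)).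
    apply: leq_add.
      apply: (@leq_trans (2 * (n * (3 * (a * q8) + 6 * K * q8)))).
        by rewrite !leq_mul2l leq_add2l le6 !orbT.
      have -> : 2 * (n * (3 * (a * q8) + 6 * K * q8)) = 2 * (3 * a + 6 * K) * q8 * n by ring.
      by rewrite !leq_mul // leq_addr.
    have -> : 1776 * q2 * L * n = L * (n * (1776 * q2)) by ring.
    by rewrite !leq_mul2l lin !orbT.
  by ring.
have [A SA] := @dense_protocol n t L lt_t isT; exists A; apply: weaken SA.
have := powq 4 8 isT => le_q8.
apply: (@leq_trans (48 * K ^ 2 * q ^ 8 * n)); last first.
  by apply: leq_trans (leq_addr _ _); rewrite !leq_mul // leq_addl.
apply: (@leq_trans (48 * K ^ 2 * q ^ 4 * n)); last by rewrite leq_mul // leq_mul.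
apply: (@leq_trans (3 * (16 * d ^ 2 * n))).
  by rewrite -mulnn leq_mul2l leq_mul2r (ltnW lt16) orbT.
by apply: eq_leq; rewrite /d; ring.
Qed.

Local Open Scope ring_scope.

(** * Real bounds *)

Lemma ln2_gt0 (R : realType) : 0 < ln (2 : R).
Proof. by rewrite ln_gt0 // ltr1n. Qed.

Lemma le_lg (R : realType) k n : (2 ^ k <= n)%N -> k%:R <= lg (n%:R : R).
Proof.
move=> le_n; rewrite /lg ler_pdivlMr ?ln2_gt0 // mulr_natl -lnXn // -natrX ler_ln ?ler_nat //.
  by rewrite posrE ltr0n expn_gt0.
by rewrite posrE ltr0n (leq_trans _ le_n) // expn_gt0.
Qed.

(** With y = n / (n - t) one has q <= 2y, so the left side is at most (256 C + 7104 (l + 1)) y^8 n.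
    Since C + 1 <= l, the factor 5^8 = 25^4 covers this amply. *)
Lemma message_bound (R : realType) (C n t L q : nat) (l : R) : (t < n)%N ->
  (q * (n - t) <= 2 * n)%N ->
  L%:R <= l + 1 -> C%:R + 1 <= l ->
  (C * q ^ 8 * n + 1776 * q ^ 2 * L * n)%:R <=
    (5 / (1 - t%:R / n%:R)) ^+ 8 * n%:R * l.
Proof.
move=> lt_t le_q lgL lgC.
have m_gt0 : 0 < (n - t)%:R :> R by rewrite ltr0n subn_gt0.
have n_gt0 : 0 < n%:R :> R by rewrite ltr0n (leq_ltn_trans _ lt_t).
set y : R := n%:R / (n - t)%:R.
have yE : 5 / (1 - t%:R / n%:R) = 5 * y.
  rewrite /y natrB; last exact: ltnW.
  have nz : n%:R - t%:R != 0 :> R by rewrite -natrB ?gt_eqF // ltnW.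
  by field; rewrite nz gt_eqF.
have y_ge1 : 1 <= y by rewrite ler_pdivlMr // mul1r ler_nat leq_subr.
have q_le : q%:R <= 2 * y by rewrite /y mulrA ler_pdivlMr // -!natrM ler_nat.
have y2 : y ^+ 2 <= y ^+ 8 by rewrite ler_weXn2l.
have q8 : q%:R ^+ 8 <= 256 * y ^+ 8.
  have -> : 256 * y ^+ 8 = (2 * y) ^+ 8 by ring.
  by rewrite lerXn2r ?nnegrE //; lra.
have q2 : q%:R ^+ 2 <= 4 * y ^+ 8.
  apply: (@le_trans _ _ ((2 * y) ^+ 2)); first by rewrite lerXn2r ?nnegrE //; lra.
  by rewrite exprMn; lra.
have y8 : 0 <= y ^+ 8 by rewrite exprn_ge0 //; lra.
rewrite yE; have -> : (C * q ^ 8 * n + 1776 * q ^ 2 * L * n)%:R =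
    (C%:R * q%:R ^+ 8 + 1776 * q%:R ^+ 2 * L%:R) * n%:R :> R.
  by rewrite mulrDl -!natrX -!natrM -natrD.
have -> : (5 * y) ^+ 8 * n%:R * l = 25 * 25 * 25 * 25 * y ^+ 8 * l * n%:R by ring.
rewrite ler_pM2r //.
have C_ge0 : 0 <= C%:R :> R by [].
have e1 : C%:R * q%:R ^+ 8 <= C%:R * (256 * y ^+ 8) by rewrite ler_wpM2l.
have e2 : 1776 * q%:R ^+ 2 * L%:R <= 1776 * (4 * y ^+ 8) * (l + 1).
  by rewrite ler_pM ?mulr_ge0 ?exprn_ge0 // ler_wpM2l.
apply: le_trans (lerD e1 e2) _.
have -> : C%:R * (256 * y ^+ 8) + 1776 * (4 * y ^+ 8) * (l + 1) =
  (256 * C%:R + 7104 * (l + 1)) * y ^+ 8 by ring.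
by rewrite [X in _ <= X]mulrAC ler_wpM2r //; lra.
Qed.

Theorem theorem8 (R : realType) :
  exists A : forall n t : nat, protocol n,
  exists N : nat, forall n t : nat, (N <= n)%N -> (t < n)%N ->
  let alpha : R := t%:R / n%:R in
  [/\ solves_consensus (A n t) t,
      runs_within (A n t) t (n%:R + 3 * (1 + lg (n%:R : R)))
    & sends_at_most (A n t) t
        ((5 / (1 - alpha)) ^+ 8 * n%:R * lg (n%:R : R))].
Proof.
have [C HC] := consensus_protocol.
have HA n t : exists A : protocol n, (t < n)%N -> let q := (n %/ (n - t)).+1 in
    let L := (trunc_log 2 n).+1 in
    solves_within A t (n.-1 + L + L.*2) (C * q ^ 8 * n + 1776 * q ^ 2 * L * n).
  have [/HC[A HA]|_] := ltnP t n; first by exists A.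
  (* A default value for t >= n, where nothing is claimed. *)
  by exists (@flood_probe_query n 0 0 (fun _ _ => true) (fun _ _ => set0) (fun _ _ => set0)).
(* The threshold 2^(C+1) ensures C + 1 <= lg n. *)
exists (fun n t => projT1 (cid (HA n t))), (2 ^ C.+1)%N => n t le_n lt_t alpha.
move: (projT1 _) (projT2 (cid (HA n t)) lt_t) => A /=.
set q := (n %/ _).+1; set L := (trunc_log 2 n).+1 => SA.
have n_gt0 : (0 < n)%N by apply: leq_ltn_trans lt_t.
have lgL : L%:R <= lg (n%:R : R) + 1 by rewrite -natr1 lerD2r le_lg ?trunc_logP.
have lgC : C%:R + 1 <= lg (n%:R : R) by rewrite natr1 le_lg.
split=> F x leF; case: (SA F x leF) => // _ halt msg.
- exists (n.-1 + L + L.*2)%N; split=> //.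
  have -> : (n.-1 + L + L.*2 = n.-1 + 3 * L)%N by lia.
  have : n.-1%:R + 1 = n%:R :> R by rewrite natr1 prednK.
  by rewrite natrD natrM; lra.
have le_q : (q * (n - t) <= 2 * n)%N.
  by rewrite /q mulSn; have := leq_trunc_div n (n - t); lia.
move=> T; apply: le_trans (message_bound lt_t le_q lgL lgC).
by rewrite ler_nat; apply: msg.
Qed.
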